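(* Let $K$ be a field, let $Q=(Q_0,Q_1,h,t)$ be a finite quiver, and let $I$ and $S$ be disjoint subsets of $Q_1$. If $Q$ has no oriented $I$-cycles and no oriented $S$-cycles, then $\mathrm{Rep}^{I,S}\,Q$ is functorially finite in $\mathrm{Rep}\,Q$.
   Context: A quiver is a tuple $Q=(Q_0,Q_1,h,t)$ with $Q_0$ a set of vertices, $Q_1$ a set of arrows, and $h,t:Q_1\to Q_0$ assigning to each arrow its head and tail, so $a:t(a)\to h(a)$. $\mathrm{Rep}\,Q$ is the category of finite-dimensional representations of $Q$ over the field $K$. For subsets $I,S\subseteq Q_1$, $\mathrm{Rep}^{I,S}\,Q$ is the full subcategory of $\mathrm{Rep}\,Q$ consisting of those representations in which the linear map of every arrow in $I$ is injective and the linear map of every arrow in $S$ is surjective. For $A\subseteq Q_1$, an oriented $A$-cycle is a word $w_0w_1\cdots w_{n-1}$ with $n\ge 1$, where subscripts are taken modulo $n$, such that each letter $w_i$ is either an arrow in $Q_1$ or a formal inverse $a^{-1}$ with $a\in A$, consecutive letters $w_i,w_{i+1}$ are not inverses of each other, and $t(w_i)=h(w_{i+1})$ for all $i$, with the convention $h(a^{-1})=t(a)$ and $t(a^{-1})=h(a)$. (In particular ordinary oriented cycles of $Q$ are oriented $A$-cycles for every $A$.) A full subcategory $\mathcal{C}$ of $\mathrm{Rep}\,Q$ is covariantly finite if for every $X$ in $\mathrm{Rep}\,Q$ there is a morphism $f:X\to Y$ with $Y$ in $\mathcal{C}$ such that every morphism from $X$ to an object of $\mathcal{C}$ factors through $f$;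 it is contravariantly finite if for every $X$ in $\mathrm{Rep}\,Q$ there is a morphism $g:Y\to X$ with $Y$ in $\mathcal{C}$ such that every morphism from an object of $\mathcal{C}$ to $X$ factors through $g$. It is functorially finite if it is both covariantly and contravariantly finite. *)

(* Defs.v *)
From HB Require Import structures.
From mathcomp Require Import all_boot all_order all_algebra.

Set Implicit Arguments.
Unset Strict Implicit.
Unset Printing Implicit Defensive.

Import GRing.Theory.
Local Open Scope ring_scope.

Record quiver := Quiver {
  vertex : finType;
  arrow : finType;
  arrow_head : arrow -> vertex;
  arrow_tail : arrow -> vertex
}.

(* [inl a] is the letter a, [inr a] is the formal inverse of a. *)
Definition letter (Q : quiver) : eqType := (arrow Q + arrow Q)%type.

Definition letter_head (Q : quiver) (w : letter Q) : vertex Q :=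
  match w with inl a => arrow_head a | inr a => arrow_tail a end.

Definition letter_tail (Q : quiver) (w : letter Q) : vertex Q :=
  match w with inl a => arrow_tail a | inr a => arrow_head a end.

Definition letter_inv (Q : quiver) (w : letter Q) : letter Q :=
  match w with inl a => inr a | inr a => inl a end.

Definition letter_over (Q : quiver) (A : {set arrow Q}) (w : letter Q) : bool :=
  match w with inl _ => true | inr a => a \in A end.

Definition letter_next (Q : quiver) : rel (letter Q) :=
  fun w w' => (letter_tail w == letter_head w') && (w' != letter_inv w).

(* [cycle] also tests the pair formed by the last and the first letter, so
   subscripts are indeed read modulo the length of the word. *)
Definition oriented_cycle (Q : quiver) (A : {set arrow Q})
    (w : seq (letter Q)) : bool :=
  [&& (0 < size w)%N, all (letter_over A) w & cycle (@letter_next Q) w].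

Record rep (K : fieldType) (Q : quiver) := Rep {
  rep_space : vertex Q -> vectType K;
  rep_map : forall a : arrow Q, 'Hom(rep_space (arrow_tail a), rep_space (arrow_head a))
}.

Record rep_hom (K : fieldType) (Q : quiver) (X Y : rep K Q) := RepHom {
  hom_map :> forall v : vertex Q, 'Hom(rep_space X v, rep_space Y v);
  hom_mapP : forall a : arrow Q,
    (rep_map Y a \o hom_map (arrow_tail a))%VF = (hom_map (arrow_head a) \o rep_map X a)%VF
}.

(* A full subcategory is given by its class of objects. *)
Definition rep_IS (K : fieldType) (Q : quiver) (I S : {set arrow Q})
    (X : rep K Q) : Prop :=
  (forall a, a \in I -> injective (rep_map X a)) /\
  (forall a, a \in S -> forall y, exists x, rep_map X a x = y).

Definition covariantly_finite (K : fieldType) (Q : quiver)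
    (C : rep K Q -> Prop) : Prop :=
  forall X : rep K Q, exists (Y : rep K Q) (f : rep_hom X Y),
    C Y /\
    forall (Z : rep K Q) (u : rep_hom X Z), C Z ->
      exists k : rep_hom Y Z, forall v, u v = (k v \o f v)%VF.

Definition contravariantly_finite (K : fieldType) (Q : quiver)
    (C : rep K Q -> Prop) : Prop :=
  forall X : rep K Q, exists (Y : rep K Q) (g : rep_hom Y X),
    C Y /\
    forall (Z : rep K Q) (u : rep_hom Z X), C Z ->
      exists k : rep_hom Z Y, forall v, u v = (g v \o k v)%VF.

Definition functorially_finite (K : fieldType) (Q : quiver)
    (C : rep K Q -> Prop) : Prop :=
  covariantly_finite C /\ contravariantly_finite C.

(* Main.v *)
Require Import Defs.
From HB Require Import structures.
From mathcomp Require Import all_boot all_order all_algebra.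

Set Implicit Arguments.
Unset Strict Implicit.
Unset Printing Implicit Defensive.

Import GRing.Theory.
Local Open Scope ring_scope.

(** Taking duals exchanges injective and surjective maps and reverses the
arrows, so covariant finiteness for (I, S) on Q is contravariant finiteness
for (S, I) on the opposite quiver ([covariantly_finite_dual]). It remains to
find, for every X, a right approximation U -> X by an object of Rep^{I,S}
([contravariantly_finite_rep_IS]).

The condition on I is stable under subobjects and the one on S under
quotients. Hence it is enough to find a right approximation Y -> X of X by
objects injective on I: the largest subrepresentation U contained in Y whose
S-maps are surjective ([largest_sub_onto]) stays injective on I, and it contains the image
of every morphism from an object of Rep^{I,S} to Y.

To build Y, embed X into the injective representation whose value at v is the
product, over all paths p from v, of the spaces of X at the end of p; a
morphism Z -> X becomes the family of composites Z_v -> Z_end(p) -> X_end(p).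
If Z is injective on I, choose a left inverse of Z_a for each a in I: then these
families make sense for every reduced walk that may run backwards along arrows
of I, not only for paths. Therefore replace the injective representation by the
coinduced one E, with E_v the product over all reduced walks from v, on which
the arrows of I act by bijections: prolonging and reducing by such an arrow
matches the reduced walks from its head with those from its tail. The subspace Y
of E cut out by requiring that the coordinates at paths come from an element
of X is then injective on I, and every Z -> X lifts to it ([lift_sub],
[lift_map]).

The products are finite because, without oriented I-cycles, a reduced walk
never returns to a vertex ([walk_closed_nil], [walk_size]). *)

Lemma linfunK (K : fieldType) (U V : vectType K) (f : U -> V) :
  linear f -> linfun f =1 f.
Proof.
move=> lf x; pose g : {linear U -> V} :=
  HB.pack f (GRing.isLinear.Build K U V _ f lf).
exact: (lfunE g x).
Qed.

(** * Reduced walks *)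

Section Walks.

Variables (Q : quiver) (A : {set arrow Q}).
Implicit Types (v : vertex Q) (l : letter Q) (s : seq (letter Q)).

(** Walks are listed in the order in which their letters are traversed, the
reverse of the order of composition used for oriented cycles. *)
Definition follows : rel (letter Q) := fun l l' => letter_next l' l.

Definition walk v s :=
  [&& all (letter_over A) s, sorted follows s
    & if s is l :: _ then letter_tail l == v else true].

Definition walk_end v s := last v (map (@letter_head Q) s).

Lemma letter_invK : involutive (@letter_inv Q).
Proof. by case. Qed.

Lemma walk_cons v l s :
  walk v (l :: s) = [&& letter_over A l, letter_tail l == v,
    walk (letter_head l) s & ohead s != Some (letter_inv l)].
Proof.
rewrite /walk; case: s => [|l' s] //=; first by rewrite !andbT.
rewrite /follows /letter_next (eq_sym _ (letter_head l)).
have -> : (l == letter_inv l') = (l' == letter_inv l).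
  by rewrite eq_sym (inv_eq letter_invK).
have -> : (Some l' != Some (letter_inv l)) = (l' != letter_inv l) by [].
case: (letter_over A l) => //=; case: (letter_tail l == v); rewrite ?andbF ?andbT //=.
case: (letter_head l == _); case: (l' != _); rewrite ?andbF ?andbT //=.
Qed.

Lemma walk_cat v s1 s2 :
  walk v (s1 ++ s2) -> walk v s1 /\ walk (walk_end v s1) s2.
Proof.
elim: s1 v => [|l s1 IH] v //=; rewrite !walk_cons => /and4P[-> -> /IH[-> ws2]].
rewrite /walk_end /= in ws2 *; case: s1 {IH} ws2 => //= *; split => //.
Qed.

(** A closed reduced walk whose last letter is not the inverse of its first is
an oriented cycle; otherwise deleting both letters leaves a shorter closed
reduced walk. *)
Lemma walk_closed_nil v s : (forall w, ~ oriented_cycle A w) ->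
  walk v s -> walk_end v s = v -> s = [::].
Proof.
move=> acyc; have [n] := ubnP (size s); elim: n v s => // n IH v [|l s] //= sn.
move=> ws; rewrite /walk_end /= => end_s; exfalso.
have [back|noback] := eqVneq l (letter_inv (last l s)); last first.
  apply: (acyc (rev (l :: s))).
  rewrite /oriented_cycle size_rev all_rev rev_cycle /= rcons_path.
  case/and3P: ws => /= -> -> /eqP tl; rewrite /= /letter_next tl -end_s last_map eqxx /=.
  by rewrite -(inv_eq letter_invK) eq_sym.
case/lastP: s back sn ws end_s => [|s l'] /=; first by case: l.
rewrite last_rcons size_rcons ltnS map_rcons last_rcons => back sn ws end_s.
move: ws; rewrite -end_s back walk_cons letter_invK -cats1 => /and4P[_ _].
have -> : letter_head (letter_inv l') = letter_tail l' by case: (l').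
move=> /walk_cat[ws wl'] not_back.
have s0 : s = [::].
  apply: IH ws _; first exact: ltnW.
  by move: wl'; rewrite walk_cons => /and4P[_ /eqP].
by rewrite s0 /= eqxx in not_back.
Qed.

Lemma walk_size v s : (forall w, ~ oriented_cycle A w) ->
  walk v s -> (size s <= #|vertex Q|)%N.
Proof.
move=> acyc ws; suff /card_uniqP un : uniq (v :: map (@letter_head Q) s).
  have := max_card (mem (v :: map (@letter_head Q) s)).
  by rewrite un /= size_map; apply: ltnW.
elim: s v ws => [|l s IH] v //= ws.
apply/andP; split; last first.
  by move: ws; rewrite walk_cons => /and4P[_ _ /IH].
apply/negP => /= v_in.
have [l' l'_in v_def] : exists2 l', l' \in l :: s & v = letter_head l'.
  by apply/mapP.
case/splitPr: l'_in ws => s1 s2; rewrite -cat_rcons => /walk_cat[ws1 _].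
have := walk_closed_nil acyc ws1; rewrite /walk_end map_rcons last_rcons -v_def.
by move/(_ erefl); case: (s1).
Qed.

(** The reduced form of the walk that goes along [a] and then along [s]. *)
Definition step (a : arrow Q) s :=
  if s is l :: s' then if l == inr a then s' else inl a :: s else [:: inl a].

Lemma walk_step a s :
  walk (arrow_head a) s -> walk (arrow_tail a) (step a s).
Proof.
case: s => [|l s] ws; first by rewrite walk_cons /= eqxx.
rewrite /step; case: eqP => [l_def|/eqP l_a].
  by move: ws; rewrite l_def walk_cons => /and4P[].
by rewrite walk_cons /= eqxx ws.
Qed.

(** This is why arrows of [A] act injectively on functions of reduced walks:
going back along [a] first provides the preimage. *)
Lemma step_onto a s : a \in A -> walk (arrow_tail a) s ->
  exists2 s', walk (arrow_head a) s' & step a s' = s.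
Proof.
move=> aA ws; case: (boolP (ohead s == Some (inl a))) => [|not_a]; last first.
  by exists (inr a :: s); rewrite /= ?eqxx // walk_cons /= aA eqxx ws.
case: s ws => //= l s; rewrite walk_cons => /and4P[_ _ ws /= not_a] /eqP[l_a].
exists s; rewrite l_a in ws not_a *; first by [].
by case: s not_a {ws} => //= l' s not_a; rewrite ifN.
Qed.

End Walks.

(** * The largest subfamily with surjective maps *)

Section LargestSub.

Variables (K : fieldType) (Q : quiver) (S : {set arrow Q}) (E : vectType K).
Variable f : arrow Q -> 'End(E).

Definition sub_onto (U : vertex Q -> {vspace E}) :=
  (forall a, f a @: U (arrow_tail a) <= U (arrow_head a))%VS /\
  (forall a, a \in S -> U (arrow_head a) <= f a @: U (arrow_tail a))%VS.

Definition is_largest_sub_onto (Y U : vertex Q -> {vspace E}) :=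
  [/\ sub_onto U, forall v, (U v <= Y v)%VS & forall W, sub_onto W ->
    (forall v, W v <= Y v)%VS -> forall v, (W v <= U v)%VS].

(** Whenever a condition fails, one space of the family can be replaced by a
smaller one that still contains every admissible subfamily; the total dimension
drops, so this stops. *)
Lemma largest_sub_onto (Y : vertex Q -> {vspace E}) :
  exists U, is_largest_sub_onto Y U.
Proof.
have [n] := ubnP (\sum_v \dim (Y v)); elim: n Y => // n IH Y ltn.
pose bad1 a := ~~ (f a @: Y (arrow_tail a) <= Y (arrow_head a))%VS.
pose bad2 a := (a \in S) && ~~ (Y (arrow_head a) <= f a @: Y (arrow_tail a))%VS.
have shrink v (B : {vspace E}) : ~~ (Y v <= B)%VS ->
    (forall W, sub_onto W -> (forall v, W v <= Y v)%VS -> (W v <= B)%VS) ->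
  exists U, is_largest_sub_onto Y U.
  move=> nYB sB; pose Y' w := if w == v then (Y w :&: B)%VS else Y w.
  have Y'Y w : (Y' w <= Y w)%VS by rewrite /Y'; case: eqP => // _; apply: capvSl.
  have [|U [okU UY' Umax]] := IH Y'.
    rewrite ltnS in ltn; apply: leq_trans ltn.
    rewrite (bigD1 v) // [X in (_ < X)%N](bigD1 v) //=.
    rewrite -addSn leq_add ?leq_sum // => [|w _]; last exact: dimvS.
    rewrite /Y' eqxx ltn_neqAle dimvS ?capvSl // andbT.
    apply: contra nYB => /eqP dd; have : (Y v :&: B == Y v)%VS.
      by rewrite eqEdim capvSl dd leqnn.
    by move/eqP/capv_idPl.
  exists U; split=> // [w|W okW WY w]; first exact: subv_trans (UY' w) _.
  apply: Umax => // u; rewrite /Y'; case: eqP => [->|_] //.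
  by rewrite subv_cap WY sB.
have [/existsP[a] | /existsPn ok1] := boolP [exists a, bad1 a].
  rewrite /bad1 => bad; apply: (shrink (arrow_tail a) (f a @^-1: Y (arrow_head a))%VS).
    apply: contra bad => bad; apply: subv_trans (limgS _ bad) _.
    by apply/subvP=> _ /memv_imgP[x + ->]; rewrite -memv_preim.
  move=> W [W1 _] WY; apply/subvP=> x xW; rewrite -memv_preim.
  by apply/(subvP (WY _))/(subvP (W1 _))/memv_img.
have [/existsP[a /andP[aS bad]] | /existsPn ok2] := boolP [exists a, bad2 a].
  apply: (shrink _ _ bad) => W [_ W2] WY.
  exact: subv_trans (W2 _ aS) (limgS _ (WY _)).
exists Y; split=> //; split=> a; first by have := ok1 a; rewrite negbK.
by move=> aS; have := ok2 a; rewrite /bad2 aS negbK.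
Qed.

End LargestSub.

(** * Linear actions of walks *)

(** All spaces of [X] are embedded in one space [common], with retractions.
Letters then act by endomorphisms of [common] and can be composed along any
word, whether or not its letters match; on walks this is the expected composite
by [act_emb] and [act_inv_emb]. *)
Section CommonSpace.

Import VectorInternalTheory.
Variables (K : fieldType) (Q : quiver) (X : rep K Q).

Definition common_dim := \max_v dim (rep_space X v).
Definition common : vectType K := 'rV[K]_common_dim.

Definition emb v : 'Hom(rep_space X v, common) :=
  linfun (fun x => v2r x *m pid_mx (dim (rep_space X v)) : 'rV_common_dim).
Definition ret v : 'Hom(common, rep_space X v) :=
  linfun (fun w : 'rV_common_dim => r2v (w *m pid_mx (dim (rep_space X v)))).

Lemma embK v : cancel (emb v) (ret v).
Proof.
move=> x; rewrite !linfunK => [|k y z|k y z]; last 2 first.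
- by rewrite linearP mulmxDl -scalemxAl.
- by rewrite mulmxDl -scalemxAl linearP.
rewrite -mulmxA pid_mx_id ?pid_mx_1 ?mulmx1 ?v2rK //.
exact: (leq_bigmax (F := fun v => dim (rep_space X v))).
Qed.

Definition letter_act (l : letter Q) : 'End(common) :=
  match l with
  | inl a => emb (arrow_head a) \o rep_map X a \o ret (arrow_tail a)
  | inr a => emb (arrow_tail a) \o (rep_map X a)^-1 \o ret (arrow_head a)
  end%VF.

Fixpoint act (s : seq (letter Q)) : 'End(common) :=
  if s is l :: s' then (act s' \o letter_act l)%VF else \1%VF.

Lemma act_cons l s x : act (l :: s) x = act s (letter_act l x).
Proof. exact: comp_lfunE. Qed.

Lemma act_emb a s x :
  act (inl a :: s) (emb (arrow_tail a) x) = act s (emb (arrow_head a) (rep_map X a x)).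
Proof. by rewrite act_cons /= !comp_lfunE embK. Qed.

Lemma act_inv_emb a s x : injective (rep_map X a) ->
  act (inr a :: s) (emb (arrow_head a) (rep_map X a x)) = act s (emb (arrow_tail a) x).
Proof.
by move=> /lker0P inj; rewrite act_cons /= !comp_lfunE embK lker0_lfunK.
Qed.

End CommonSpace.

(** * The right approximation *)

Section Approx.

Variables (K : fieldType) (Q : quiver) (I : {set arrow Q}).
Hypothesis acyc : forall w, ~ oriented_cycle I w.
Variable X : rep K Q.

Definition word := #|vertex Q|.-bseq (arrow Q + arrow Q)%type.

(** Overlong sequences are sent to the empty one; reduced walks are never
overlong, by [walk_size]. *)
Definition to_word (s : seq (letter Q)) : word := insub_bseq _ s.

Lemma to_wordK v s : walk I v s -> to_word s = s :> seq (letter Q).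
Proof.
move=> ws; rewrite /to_word /insub_bseq insubdK //.
exact: walk_size ws.
Qed.

(** The value at every vertex [v] of the coinduced representation: functions
of walks, of which only the coordinates at walks from [v] are meaningful.
[coind_sub v] forces the others to vanish. *)
Definition coind : vectType K := {ffun word -> common X}.

Definition coind_map (a : arrow Q) : 'End(coind) :=
  linfun (fun e : coind => [ffun t : word =>
    if walk I (arrow_head a) t then e (to_word (step a t)) else 0] : coind).

Lemma coind_mapE a (e : coind) t : coind_map a e t =
  if walk I (arrow_head a) t then e (to_word (step a t)) else 0.
Proof.
rewrite linfunK ?ffunE // => k e1 e2; apply/ffunP=> s; rewrite !ffunE.
by case: ifP => _; rewrite ?scaler0 ?addr0.
Qed.

Definition positive (s : seq (letter Q)) :=
  all (fun l => if l is inl _ then true else false) s.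

(** The kernel of [defect v] consists of the families supported on walks from
[v] whose coordinates at paths are the images of an element of [X] at [v]; that
element is recovered from the coordinate at the empty walk. At the empty walk
the equation says that the coordinate lies in the image of [emb X v]. *)
Definition defect v : 'End(coind) :=
  linfun (fun e : coind => [ffun t : word =>
    if walk I v t then
      if positive t then e t - act X t (emb X v (ret X v (e (to_word [::])))) else 0
    else e t] : coind).

Definition coind_sub v := lker (defect v).

Lemma coind_subP v (e : coind) : reflect
  ((forall t : word, ~~ walk I v t -> e t = 0) /\
   forall t : word, walk I v t -> positive t ->
     e t = act X t (emb X v (ret X v (e (to_word [::])))))
  (e \in coind_sub v).
Proof.
have dE t : defect v e t = if walk I v t then
      if positive t then e t - act X t (emb X v (ret X v (e (to_word [::])))) else 0
    else e t.
  rewrite linfunK ?ffunE // => k e1 e2; apply/ffunP=> s; rewrite !ffunE.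
  case: ifP => _ //; case: ifP => _; rewrite ?scaler0 ?addr0 // !linearP.
  by rewrite /= addrACA -scalerDr.
rewrite memv_ker; apply: (iffP eqP) => [e0|[off pos]].
  split=> t wt => [|pt]; have := dE t; rewrite e0 ffunE.
    by rewrite (negPf wt).
  by rewrite wt pt => /esym/eqP; rewrite subr_eq0 => /eqP.
apply/ffunP=> t; rewrite dE ffunE; case: ifP => [wt|/negbT/off //].
by case: ifP => // pt; rewrite -pos // subrr.
Qed.

Lemma walk_nil v : walk I v [::]. Proof. by []. Qed.

Lemma coind_ret a (e : coind) : e \in coind_sub (arrow_tail a) ->
  coind_map a e (to_word [::]) =
    emb X (arrow_head a) (rep_map X a (ret X (arrow_tail a) (e (to_word [::])))).
Proof.
move=> /coind_subP[_ pos].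
rewrite coind_mapE (to_wordK (walk_nil (arrow_head a))) /=.
have w1 : walk I (arrow_tail a) [:: inl a] by rewrite walk_cons /= eqxx.
by rewrite pos (to_wordK w1) // act_emb /= id_lfunE.
Qed.

Lemma coind_sub_inj a (e : coind) : a \in I -> e \in coind_sub (arrow_tail a) ->
  coind_map a e = 0 -> e = 0.
Proof.
move=> aI /coind_subP[off _] e0; apply/ffunP=> t; rewrite ffunE.
have [wt|/off //] := boolP (walk I (arrow_tail a) t).
have [s ws st] := step_onto aI wt.
have := coind_mapE a e (to_word s); rewrite e0 ffunE (to_wordK ws) ws st.
move->; congr (e _); apply/val_inj; rewrite /= (to_wordK wt) //.
Qed.

Section Lift.

Variables (Z : rep K Q) (u : rep_hom Z X).
Hypothesis injZ : forall a, a \in I -> injective (rep_map Z a).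

Definition end_map v : 'Hom(common Z, common X) := (emb X v \o u v \o ret Z v)%VF.

(** The morphism into the coinduced representation determined by [u]: follow
the walk in [Z], going backwards along arrows of [I] through the chosen left
inverses, then apply [u]. *)
Definition lift v : 'Hom(rep_space Z v, coind) :=
  linfun (fun z => [ffun t : word => if walk I v t then
     end_map (walk_end v t) (act Z t (emb Z v z)) else 0] : coind).

Lemma liftE v z t : lift v z t = if walk I v t then
     end_map (walk_end v t) (act Z t (emb Z v z)) else 0.
Proof.
rewrite linfunK ?ffunE // => k e1 e2; apply/ffunP=> s; rewrite !ffunE.
by case: ifP => _; rewrite ?scaler0 ?addr0 // !linearP.
Qed.

Lemma lift_nil v z : lift v z (to_word [::]) = emb X v (u v z).
Proof.
by rewrite liftE (to_wordK (walk_nil v)) /= id_lfunE !comp_lfunE embK.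
Qed.

Lemma lift_positive v z s : walk I v s -> positive s ->
  end_map (walk_end v s) (act Z s (emb Z v z)) = act X s (emb X v (u v z)).
Proof.
elim: s v z => [|l s IH] v z; first by rewrite /= !id_lfunE !comp_lfunE embK.
case: l => // a; rewrite walk_cons => /and4P[_ /eqP /= v_def ws _] ps.
case: v / v_def z => z; rewrite !act_emb.
rewrite [walk_end _ _]/(walk_end (arrow_head a) s) IH //.
congr (act X s (emb X _ _)).
by have /lfunP/(_ z) := hom_mapP u a; rewrite !comp_lfunE.
Qed.

Lemma lift_sub v z : lift v z \in coind_sub v.
Proof.
apply/coind_subP; rewrite lift_nil embK; split=> t wt.
  by rewrite liftE (negPf wt).
by move=> pt; rewrite liftE wt lift_positive.
Qed.

(** Compatibility with arrows is where injectivity of [Z] on [I] enters: if the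
walk starts by going back along [a], the left inverse undoes [rep_map Z a]. *)
Lemma lift_map a z :
  coind_map a (lift (arrow_tail a) z) = lift (arrow_head a) (rep_map Z a z).
Proof.
apply/ffunP=> t; rewrite coind_mapE [RHS]liftE; case: ifP => // wt.
have wt' := walk_step wt; rewrite liftE (to_wordK wt') wt'.
case: (val t : seq (letter Q)) wt {wt'} => [|l s] wt; first by rewrite /step act_emb.
rewrite /step; case: eqP => [l_def|_]; last by rewrite act_emb.
move: wt; rewrite l_def walk_cons => /and4P[aI _ _ _].
by rewrite act_inv_emb //; apply: injZ.
Qed.

End Lift.

End Approx.

(** Lifting to the largest subfamily works because the image of a
representation surjective on [S] is again surjective on [S], so that it lies in
that subfamily. *)
Theorem contravariantly_finite_rep_IS (K : fieldType) (Q : quiver) (I S : {set arrow Q})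
    (noI : forall w : seq (letter Q), ~ oriented_cycle I w) :
  contravariantly_finite (@rep_IS K Q I S).
Proof.
move=> X.
have [U [[U1 U2] UY Umax]] :=
  largest_sub_onto S (coind_map I X) (coind_sub I X).
pose Ymap a : 'Hom(subvs_of (U (arrow_tail a)), subvs_of (U (arrow_head a))) :=
  linfun (vsproj (U (arrow_head a)) \o coind_map I X a \o vsval).
have YE a y : vsval (Ymap a y) = coind_map I X a (vsval y).
  rewrite /Ymap lfunE /= vsprojK //.
  by apply: (subvP (U1 a)); apply/memv_img/subvsP.
pose Y := @Rep K Q (fun v => subvs_of (U v)) Ymap.
pose g v : 'Hom(subvs_of (U v), rep_space X v) :=
  linfun (fun y : subvs_of (U v) => ret X v ((vsval y : coind X) (to_word [::]))).
have gE v y : g v y = ret X v ((vsval y : coind X) (to_word [::])).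
  by rewrite /g linfunK // => k y1 y2; rewrite linearP /= !ffunE linearP.
have gP a : (rep_map X a \o g (arrow_tail a))%VF = (g (arrow_head a) \o Ymap a)%VF.
  apply/lfunP=> y; rewrite !comp_lfunE !gE YE coind_ret ?embK //.
  exact: (subvP (UY _) _ (subvsP y)).
exists Y, (@RepHom K Q Y X g gP); split.
  split=> a aA /=.
    apply/lker0P/eqP/vspaceP=> y; rewrite memv_ker memv0.
    apply/eqP/eqP=> [y0|->]; last exact: linear0.
    apply/val_inj => /=; apply: (coind_sub_inj noI aA (subvP (UY _) _ (subvsP y))).
    by rewrite -YE y0.
  move=> y; have /memv_imgP[x xU xy] := subvP (U2 _ aA) _ (subvsP y).
  by exists (vsproj (U _) x); apply/val_inj; rewrite /= YE vsprojK.
move=> Z u [Zinj Zsur].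
have fU v z : lift I u v z \in U v.
  apply: (subvP (Umax (fun v => limg (lift I u v)) _ _ v)).
  - split=> a => [|aS]; apply/subvP=> _ /memv_imgP[e + ->].
      by case/memv_imgP=> z' _ ->; rewrite lift_map // memv_img ?memvf.
    by move=> _; have [z' <-] := Zsur _ aS e; rewrite -lift_map // !memv_img ?memvf.
  - by move=> w; apply/subvP=> _ /memv_imgP[e _ ->]; apply: lift_sub.
  - by rewrite memv_img ?memvf.
pose k v : 'Hom(rep_space Z v, subvs_of (U v)) := linfun (vsproj (U v) \o lift I u v).
have kE v z : vsval (k v z) = lift I u v z by rewrite /k lfunE /= vsprojK.
have kP a : (Ymap a \o k (arrow_tail a))%VF = (k (arrow_head a) \o rep_map Z a)%VF.
  by apply/lfunP=> z; apply/val_inj; rewrite !comp_lfunE /= YE !kE lift_map.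
exists (@RepHom K Q Z Y k kP) => v; apply/lfunP=> z /=.
by rewrite comp_lfunE gE kE lift_nil // embK.
Qed.

(** * Duality *)

Section VectDual.

Variable K : fieldType.

Definition vdual (V : vectType K) : vectType K := 'Hom(V, K^o).

Definition transpose (V W : vectType K) (f : 'Hom(V, W)) : 'Hom(vdual W, vdual V) :=
  linfun (fun p : 'Hom(W, K^o) => (p \o f)%VF).

Lemma transposeE (V W : vectType K) (f : 'Hom(V, W)) (p : 'Hom(W, K^o)) :
  transpose f p = (p \o f)%VF.
Proof.
by rewrite linfunK // => k p1 p2; rewrite comp_lfunDl -comp_lfunZl.
Qed.

Lemma transpose_comp (U V W : vectType K) (f : 'Hom(V, W)) (g : 'Hom(U, V)) :
  transpose (f \o g) = (transpose g \o transpose f)%VF.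
Proof. by apply/lfunP=> p; rewrite comp_lfunE !transposeE comp_lfunA. Qed.

Definition bidual (V : vectType K) : 'Hom(V, vdual (vdual V)) :=
  linfun (fun x : V => linfun (fun p : 'Hom(V, K^o) => p x)).

Lemma bidualE (V : vectType K) (x : V) (p : 'Hom(V, K^o)) :
  (bidual V x : 'Hom(vdual V, K^o)) p = p x.
Proof.
have evE y (q : 'Hom(V, K^o)) : linfun (fun p : 'Hom(V, K^o) => p y) q = q y :> K^o.
  by rewrite linfunK // => k q1 q2; rewrite !lfun_simp.
by rewrite linfunK ?evE // => k y z; apply/lfunP=> q; rewrite !lfun_simp /= !evE linearP.
Qed.

Lemma bidual_inj (V : vectType K) : lker (bidual V) == 0%VS.
Proof.
apply/eqP/vspaceP=> x; rewrite memv_ker memv0.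
apply/eqP/eqP=> [x0|->]; last exact: linear0.
rewrite (coord_vbasis (memvf x)) big1 // => i _.
have lin : linear (coord (vbasis {:V}) i : V -> K^o) by move=> k y z; rewrite linearP.
have := bidualE x (linfun (coord (vbasis {:V}) i : V -> K^o)).
by rewrite x0 zero_lfunE linfunK // => <-; rewrite scale0r.
Qed.

Lemma dim_vdual (V : vectType K) : dim (vdual V) = dim V.
Proof. by rewrite /dim /= muln1. Qed.

Lemma bidual_surj (V : vectType K) : limg (bidual V) = fullv.
Proof.
apply/eqP; rewrite eqEdim subvf /= limg_dim_eq; last first.
  by rewrite (eqP (bidual_inj V)) capv0.
by rewrite !dimvf !dim_vdual.
Qed.

Lemma bidualK (V : vectType K) : ((bidual V)^-1 \o bidual V = \1)%VF.
Proof. exact: lker0_compVf (bidual_inj V). Qed.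

Lemma bidual_natural (V W : vectType K) (f : 'Hom(V, W)) :
  (transpose (transpose f) \o bidual V = bidual W \o f)%VF.
Proof.
apply/lfunP=> x; apply/lfunP=> p.
by rewrite !comp_lfunE transposeE comp_lfunE !bidualE transposeE comp_lfunE.
Qed.

Lemma bidual_inv_natural (V W : vectType K) (f : 'Hom(V, W)) :
  (f \o (bidual V)^-1 = (bidual W)^-1 \o transpose (transpose f))%VF.
Proof.
apply/lfunP=> y; have : y \in limg (bidual V) by rewrite bidual_surj memvf.
case/memv_imgP=> x _ ->; rewrite !comp_lfunE.
have /lfunP/(_ x) := bidual_natural f; rewrite !comp_lfunE => ->.
by rewrite !lker0_lfunK ?bidual_inj.
Qed.

Lemma transpose_surj (V W : vectType K) (f : 'Hom(V, W)) :
  injective f -> forall p, exists q, transpose f q = p.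
Proof.
move=> /lker0P inj p; exists (p \o f^-1)%VF.
by rewrite transposeE -comp_lfunA lker0_compVf // comp_lfun1r.
Qed.

Lemma transpose_inj (V W : vectType K) (f : 'Hom(V, W)) :
  (forall y, exists x, f x = y) -> injective (transpose f).
Proof.
move=> sur p q; rewrite !transposeE => pq; apply/lfunP=> y.
by have [x <-] := sur y; rewrite -!comp_lfunE pq.
Qed.

End VectDual.

Section RepDual.

Variable K : fieldType.

Definition opposite (Q : quiver) : quiver :=
  Quiver (@arrow_tail Q) (@arrow_head Q).

Definition dual (Q : quiver) (X : rep K Q) : rep K (opposite Q) :=
  @Rep K (opposite Q) (fun v => vdual (rep_space X v))
    (fun a => transpose (rep_map X a)).

Lemma dual_homP (Q : quiver) (X Y : rep K Q) (f : rep_hom X Y) (a : arrow Q) :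
  (transpose (rep_map X a) \o transpose (f (arrow_head a)) =
   transpose (f (arrow_tail a)) \o transpose (rep_map Y a))%VF.
Proof. by rewrite -!transpose_comp hom_mapP. Qed.

Definition dual_hom (Q : quiver) (X Y : rep K Q) (f : rep_hom X Y) :
    rep_hom (dual Y) (dual X) :=
  @RepHom K (opposite Q) (dual Y) (dual X) (fun v => transpose (f v)) (dual_homP f).

Definition comp_hom (Q : quiver) (X Y Z : rep K Q) (f : rep_hom Y Z) (g : rep_hom X Y) :
  rep_hom X Z.
Proof.
exists (fun v => f v \o g v)%VF => a.
by rewrite comp_lfunA hom_mapP -comp_lfunA hom_mapP comp_lfunA.
Defined.

Lemma dual_IS (Q : quiver) (I S : {set arrow Q}) (X : rep K Q) :
  rep_IS I S X -> rep_IS (Q := opposite Q) S I (dual X).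
Proof.
case=> inj sur; split=> a aA /=.
  exact: transpose_inj (sur a aA).
exact: transpose_surj (inj a aA).
Qed.

Lemma opposite_acyclic (Q : quiver) (A : {set arrow Q}) :
  (forall w, ~ @oriented_cycle Q A w) -> forall w, ~ @oriented_cycle (opposite Q) A w.
Proof.
move=> acyc w cyc; apply: (acyc (rev w)); move: cyc.
rewrite /oriented_cycle size_rev all_rev rev_cycle.
have -> : all (letter_over (Q := opposite Q) A) w = all (letter_over A) w.
  by apply: eq_all => -[].
suff -> : cycle (@letter_next (opposite Q)) w =
    cycle (fun l => (@letter_next Q)^~ l) w by [].
apply: eq_cycle => l l'; rewrite /letter_next.
have -> : @letter_inv (opposite Q) l = @letter_inv Q l by case: l.
have -> : @letter_tail (opposite Q) l = @letter_head Q l by case: l.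
have -> : @letter_head (opposite Q) l' = @letter_tail Q l' by case: l'.
by rewrite eq_sym; congr (_ && ~~ _); rewrite eq_sym; apply: (inv_eq (@letter_invK Q)).
Qed.

(** Dualizing a right approximation of the dual of [X] and precomposing with the
embedding of [X] into its bidual gives a left approximation of [X]. *)
Lemma covariantly_finite_dual (Q : quiver) (I S : {set arrow Q}) :
  contravariantly_finite (@rep_IS K (opposite Q) S I) ->
  covariantly_finite (@rep_IS K Q I S).
Proof.
(* With explicit fields the double opposite is convertible to the quiver. *)
case: Q I S => V A h t; set Q := Quiver h t => I S fin X.
have [Y [g [CY gP]]] := fin (dual X).
have biP (W : rep K Q) a :
    ((rep_map (dual (dual W) : rep K Q) a) \o bidual (rep_space W (arrow_tail a)) =
    bidual (rep_space W (arrow_head a)) \o rep_map W a)%VF.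
  exact: bidual_natural.
have biVP (W : rep K Q) a :
    (rep_map W a \o (bidual (rep_space W (arrow_tail a)))^-1 =
     (bidual (rep_space W (arrow_head a)))^-1 \o
       rep_map (dual (dual W) : rep K Q) a)%VF.
  exact: bidual_inv_natural.
pose biX := @RepHom K Q X (dual (dual X)) (fun v => bidual (rep_space X v)) (biP X).
exists (dual Y), (comp_hom (dual_hom g) biX).
split=> [|Z u CZ]; first exact: (dual_IS CY).
have [k kP] := gP _ (dual_hom u) (dual_IS CZ).
pose biVZ := @RepHom K Q (dual (dual Z)) Z
  (fun v => (bidual (rep_space Z v))^-1%VF) (biVP Z).
exists (comp_hom biVZ (dual_hom k)) => v.
rewrite /= -!comp_lfunA [(transpose (k v) \o _)%VF]comp_lfunA -transpose_comp -kP /=.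
by rewrite bidual_natural comp_lfunA bidualK comp_lfun1l.
Qed.

End RepDual.

Theorem theorem5p1 (K : fieldType) (Q : quiver) (I S : {set arrow Q})
    (disjIS : [disjoint I & S])
    (noI : forall w : seq (letter Q), ~ oriented_cycle I w)
    (noS : forall w : seq (letter Q), ~ oriented_cycle S w) :
  functorially_finite (@rep_IS K Q I S).
Proof.
split; last exact: contravariantly_finite_rep_IS.
apply: covariantly_finite_dual.
by apply/contravariantly_finite_rep_IS/opposite_acyclic.
Qed.
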